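(* Let $(\kappa,k_1,k_2)\in\mathcal{L}_1^1$ and $n\in\mathbb{N}$. Then for every function $f\in C_{-1,(k_1,k_2)}^{n-1}(0,+\infty)$ and all $t>0$, $$(\mathbb{I}_{(\kappa)}^{<n>}\,{}_{1L}\mathbb{D}_{(k_1,k_2)}^{<n>}\,f)(t)=f(t)-\sum_{j=0}^{n-1}(\mathbb{I}_{(k_2)}\,{}_{1L}\mathbb{D}_{(k_1,k_2)}^{<j>}\,f)(0)\,(\kappa^{<j+1>}*k_1)(t).$$
   Context: $C_{-1}(0,+\infty)$ is the space of functions $f$ on $(0,+\infty)$ of the form $f(t)=t^{p}f_1(t)$, $t>0$, with some $p>-1$ and $f_1\in C[0,+\infty)$. The symbol $*$ denotes the Laplace convolution $(f*g)(t)=\int_0^t f(t-\tau)g(\tau)\,d\tau$, $t>0$. For $n\in\mathbb{N}$, $\kappa^{<n>}$ is the convolution power: $\kappa^{<1>}=\kappa$ and $\kappa^{<n>}=\kappa*\cdots*\kappa$ ($n$ factors) for $n\ge 2$. $\mathcal{L}_1^1$ is the set of triples $(\kappa,k_1,k_2)$ of real-valued functions belonging to $C_{-1}(0,+\infty)$ with $(\kappa*k_1*k_2)(t)=1$ for all $t>0$ (1st level kernels). For $k\in C_{-1}(0,+\infty)$, the general fractional integral (GFI) is $(\mathbb{I}_{(k)}f)(t)=(k*f)(t)$, and the general fractional derivative of Riemann-Liouville type is $(\mathbb{D}_{(k)}f)(t)=\frac{d}{dt}(\mathbb{I}_{(k)}f)(t)$, $t>0$. The 1st level general fractional derivative (1st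 level GFD) is $({}_{1L}\mathbb{D}_{(k_1,k_2)}f)(t)=\left(\mathbb{I}_{(k_1)}\frac{d}{dt}\mathbb{I}_{(k_2)}f\right)(t)$. $\mathbb{I}_{(\kappa)}^{<n>}$ and ${}_{1L}\mathbb{D}_{(k_1,k_2)}^{<n>}$ denote the $n$-fold compositions of $\mathbb{I}_{(\kappa)}$ and of ${}_{1L}\mathbb{D}_{(k_1,k_2)}$ with themselves, respectively; for $n=0$ both are the identity operator. For $m\in\mathbb{N}\cup\{0\}$, $$C_{-1,(k_1,k_2)}^{m}(0,+\infty)=\{f:\ {}_{1L}\mathbb{D}_{(k_1,k_2)}^{<j>}f\in C_{-1}(0,+\infty)\ \text{and}\ \mathbb{D}_{(k_2)}\,{}_{1L}\mathbb{D}_{(k_1,k_2)}^{<j>}f\in C_{-1}(0,+\infty),\ j=0,\dots,m\}.$$ The value $(\mathbb{I}_{(k_2)}g)(0)$ is the value at $0$ of the continuous extension of $\mathbb{I}_{(k_2)}g$ to $[0,+\infty)$, i.e. $\lim_{t\to 0+}(\mathbb{I}_{(k_2)}g)(t)$. *)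

(* Defs.v *)
From mathcomp Require Import all_boot all_order all_algebra.
From mathcomp Require Import all_classical all_reals all_analysis.

Set Implicit Arguments.
Unset Strict Implicit.
Unset Printing Implicit Defensive.

Import Order.TTheory GRing.Theory Num.Theory.
Import numFieldNormedType.Exports.

Local Open Scope classical_set_scope.
Local Open Scope ring_scope.

(* A function on (0, +oo) is represented by a total function R -> R whose values
   on (-oo, 0] are irrelevant: at any t > 0, every operator below depends only on
   the values of its arguments on (0, +oo).  Cm1 is the space C_{-1}(0, +oo). *)

Definition Cm1 (R : realType) : set (R -> R) :=
  [set f | exists p : R, exists f1 : R -> R,
    [/\ -1 < p, {within `[0, +oo[, continuous f1}
      & forall t : R, 0 < t -> f t = t `^ p * f1 t]].

(* For f and g in Cm1 the integrand may be singular at both endpoints, but it is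
   integrable on ]0, t[. *)
Definition laplace_conv (R : realType) (f g : R -> R) : R -> R := fun t =>
  \int[lebesgue_measure]_(tau in `]0, t[) (f (t - tau) * g tau).

(* k * ... * k with n >= 1 factors; the value at n = 0 is a dummy. *)
Definition laplace_conv_pow (R : realType) (k : R -> R) (n : nat) : R -> R :=
  iterop n (@laplace_conv R) k (fun=> 0).

Definition kernels_1L (R : realType) (kappa k1 k2 : R -> R) : Prop :=
  [/\ Cm1 kappa, Cm1 k1, Cm1 k2
    & forall t : R, 0 < t -> laplace_conv (laplace_conv kappa k1) k2 t = 1].

Definition GFI (R : realType) (k f : R -> R) : R -> R := laplace_conv k f.

Definition GFD_RL (R : realType) (k f : R -> R) : R -> R := derive1 (GFI k f).

Definition GFD_1L (R : realType) (k1 k2 f : R -> R) : R -> R :=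
  GFI k1 (derive1 (GFI k2 f)).

(* Value at 0 of the continuous extension of GFI k g to [0, +oo). *)
Definition GFI_at0 (R : realType) (k g : R -> R) : R :=
  lim (GFI k g t @[t --> 0^'+]).

(* C^m_{-1,(k1,k2)}(0, +oo).  As derive1 is total, the existence of the derivative
   implicit in "GFD_RL k2 _ belongs to C_{-1}" is required separately. *)
Definition Cm1_1L (R : realType) (k1 k2 : R -> R) (m : nat) : set (R -> R) :=
  [set f | forall j : nat, (j <= m)%N ->
    let g := iter j (GFD_1L k1 k2) f in
    [/\ Cm1 g, forall t : R, 0 < t -> derivable (GFI k2 g) t 1
      & Cm1 (GFD_RL k2 g)]].

(* Main.v *)
Require Import Defs.
From mathcomp Require Import all_boot all_order all_algebra.
From mathcomp Require Import all_classical all_reals all_analysis.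
From mathcomp Require Import measurable_realfun ring lra.

(* Writing [h = k2 * g] (convolution), the derivative [h'] is integrable near 0,
   so [h = h(0+) + 1 * h'].  Convolving with [kappa * k1] and using
   [kappa * k1 * k2 = 1] gives
   [1 * g = h(0+) (1 * (kappa * k1)) + 1 * (kappa * (k1 * h'))]; differentiating,
   [g = h(0+) (kappa * k1) + I_kappa D g].  The theorem follows by applying this
   to the iterates of [D] at [f].  Commutativity, associativity and continuity of
   convolutions rest on the closure of C_{-1} under convolution, obtained from
   the scaling [tau = t s] of the convolution integral. *)

Set Implicit Arguments.
Unset Strict Implicit.
Unset Printing Implicit Defensive.

Import Order.TTheory GRing.Theory Num.Theory.
Import numFieldNormedType.Exports.

Local Open Scope classical_set_scope.
Local Open Scope ring_scope.

(** * Affine changes of variable *)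

Section affine_change_of_variable.
Context {R : realType}.
Local Notation mu := (@lebesgue_measure R).
Variables a b : R.
Hypothesis a0 : a != 0.

Let phi : measurableTypeR R -> measurableTypeR R := fun x => a * x + b.

Let mphi : measurable_fun [set: measurableTypeR R] phi.
Proof.
apply: continuous_measurable_fun => x; rewrite /phi.
apply: cvgD; last exact: cvg_cst.
by apply: cvgM; [exact: cvg_cst|exact: cvg_id].
Qed.

Let k : {nonneg R} := NngNum (normr_ge0 a).
Let nu : {measure set (measurableTypeR R) -> \bar R} :=
  mscale k
    (measure_function_pushforward__canonical__measure_function_Measure mu mphi).

(** By uniqueness of Lebesgue measure it suffices to test intervals []u, v]]. The preimage of one
    under [phi] is an interval of length [(v - u) / |a|], closed on the right or on the left
    according to the sign of [a], and the factor [|a|] in [nu] compensates. *)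
Let lebesgue_measure_affine (A : set (measurableTypeR R)) : measurable A ->
  mu A = nu A.
Proof.
apply: lebesgue_measure_unique => _ [[u v]] /= _ <-.
rewrite /nu /mscale /= /pushforward /phi.
have [a_gt0|a_lt0|a_eq0] := ltrgtP 0 a; last by move: a0; rewrite -a_eq0 eqxx.
- have -> : (fun x => a * x + b) @^-1` `]u, v]%classic =
      `](u - b) / a, (v - b) / a]%classic.
    apply/seteqP; split => x /=; rewrite !in_itv/= ltr_pdivrMr // ler_pdivlMr //;
      rewrite ltrBlDr lerBrDr mulrC //.
  rewrite !lebesgue_measure_itv/= !lte_fin ltr_pM2r ?invr_gt0// ltrD2r gtr0_norm//.
  case: ifP => _; rewrite ?mule0// -!EFinD -EFinM; congr EFin.
  by field; rewrite ?gt_eqF.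
- have -> : (fun x => a * x + b) @^-1` `]u, v]%classic =
      `[(v - b) / a, (u - b) / a[%classic.
    apply/seteqP; split => x /=; rewrite !in_itv/= ltr_ndivlMr // ler_ndivrMr //;
      rewrite ltrBlDr lerBrDr mulrC andbC //.
  rewrite !lebesgue_measure_itv/= !lte_fin ltr_nM2r ?invr_lt0// ltrD2r ltr0_norm//.
  case: ifP => _; rewrite ?mule0// -!EFinD -EFinM; congr EFin.
  by field; rewrite ?lt_eqF.
Qed.

Lemma ge0_integral_affine (F : R -> \bar R) :
  measurable_fun setT F -> (forall x, 0%E <= F x)%E ->
  (\int[mu]_x F x = `|a|%:E * \int[mu]_x F (a * x + b)%R)%E.
Proof.
move=> mF F0.
rewrite (@eq_measure_integral _ _ _ setT nu); last first.
  by move=> A mA _; exact: lebesgue_measure_affine.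
rewrite ge0_integral_mscale//.
by rewrite (ge0_integral_pushforward mphi).
Qed.

Lemma integrable_affine (F : R -> R) :
  mu.-integrable setT (EFin \o F) ->
  mu.-integrable setT (fun x => (F (a * x + b)%R)%:E).
Proof.
move=> /integrableP[mF Foo].
have mFphi : measurable_fun setT (fun x => (F (a * x + b)%R)%:E).
  exact: (measurableT_comp mF mphi).
apply/integrableP; split => //.
move: Foo; rewrite (@ge0_integral_affine (fun x => `|(F x)%:E|%E))//=; last first.
  by apply/measurable_EFinP; apply: measurableT_comp => //; exact/measurable_EFinP.
rewrite ltey => Foo; rewrite ltey; apply: contra_neq Foo => ->.
by rewrite gt0_muley// lte_fin normr_gt0.
Qed.

(* If one side is infinite, so is the other, and both real-valued integrals are
   then 0. *)
Lemma Rintegral_affine (F : R -> R) : measurable_fun setT F ->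
  \int[mu]_x F x = `|a| * \int[mu]_x F (a * x + b).
Proof.
move=> mF; have a1 : 0 < `|a| by rewrite normr_gt0.
have mEF : measurable_fun setT (EFin \o F) by exact/measurable_EFinP.
have -> : `|a| = fine `|a|%:E by [].
have fineZ (x : \bar R) : fine (`|a|%:E * x) = `|a| * fine x.
  case: x => [r| |]; [by []| |]; first by rewrite gt0_muley ?lte_fin //= ?mulr0.
  by rewrite gt0_muleNy ?lte_fin//= ?mulr0.
rewrite /Rintegral -fineZ; congr fine.
rewrite [LHS]integralE [in RHS]integralE.
rewrite (@ge0_integral_affine (EFin \o F)^\+%E)//; last exact: measurable_funepos.
rewrite (@ge0_integral_affine (EFin \o F)^\-%E)//; last exact: measurable_funeneg.
set X := (\int[mu]_x _)%E; set Y := (\int[mu]_x _)%E.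
have X0 : (0 <= X)%E by exact: integral_ge0.
have Y0 : (0 <= Y)%E by exact: integral_ge0.
transitivity (`|a|%:E * (X - Y))%E; last first.
  by congr (_ * (_ - _))%E; apply: eq_integral => x _; rewrite ?funeposE ?funenegE.
(* The convention [+oo - +oo = -oo] is stable under multiplication by [|a| > 0], so distributivity
   survives even when both parts are infinite. *)
move: X Y X0 Y0 => [x| |] [y| |] // X0 Y0.
- by rewrite muleBr.
- by rewrite /= gt0_muley ?lte_fin //= gt0_muleNy.
- by rewrite /= gt0_muley ?lte_fin.
- by rewrite /= gt0_muley ?lte_fin //= gt0_muleNy.
Qed.

End affine_change_of_variable.

(** * Integrability of powers and of the beta integrand *)

Section powR_integrable.
Context {R : realType}.
Local Notation mu := (@lebesgue_measure R).

Lemma continuous_at_powR (q x : R) : 0 < x -> {for x, continuous (fun y : R => y `^ q)}.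
Proof.
move=> x0; apply: differentiable_continuous; apply/derivable1_diffP.
by apply: derivable_powR; rewrite in_itv/= andbT.
Qed.

(** The intervals [F n] exhaust []0, 1[] while staying away from the singularity. On each of them
    the primitive [G] bounds the integral by [1 / (q + 1)], uniformly in [n], and monotone
    convergence carries the bound to the union. *)
Lemma integrable_powR01 (q : R) : -1 < q ->
  mu.-integrable `]0, 1[ (fun s => (s `^ q)%:E).
Proof.
move=> q1; have q1_gt0 : 0 < q + 1 by rewrite -ltrBlDr sub0r.
(* The shift to [n.+2] keeps the left endpoint strictly below 1, as the fundamental theorem
   requires. *)
pose F n : set R := `[n.+2%:R^-1, 1]%classic.
pose G (x : R) := (q + 1)^-1 * x `^ (q + 1).
have dG (x : R) : 0 < x -> is_derive x 1 G (x `^ q).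
  move=> x0; have xy : x \in `]0, +oo[ by rewrite in_itv/= andbT.
  have dp : is_derive x 1 (fun y : R => y `^ (q + 1)) ((q + 1) * x `^ q).
    apply: DeriveDef; first exact: derivable_powR.
    by rewrite -derive1E powR_derive1//= addrK.
  apply: (is_derive_eq (is_deriveZ (q + 1)^-1 dp)).
  by rewrite /GRing.scale/= mulrA mulVf ?mul1r// gt_eqF.
have intF n : (\int[mu]_(s in F n) (s `^ q)%:E <= (q + 1)^-1%:E)%E.
  have n0 : (0 : R) < n.+2%:R^-1 by rewrite invr_gt0 ltr0n.
  have Gc (x : R) : 0 < x -> {for x, continuous G}.
    move=> x0; apply: differentiable_continuous; apply/derivable1_diffP.
    by case: (dG x x0).
  rewrite (@continuous_FTC2 _ _ G).
  - rewrite -EFinB lee_fin /G powR1 mulr1 gerBl mulr_ge0 ?powR_ge0//.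
    by rewrite invr_ge0 ltW.
  - by rewrite invf_lt1 ?ltr1n ?ltr0n.
  - apply: continuous_in_subspaceT => x; rewrite inE/= in_itv/= => /andP[nx _].
    by apply: continuous_at_powR; exact: lt_le_trans nx.
  - split.
    + by move=> x; rewrite in_itv/= => /andP[nx _]; case: (dG x (lt_trans n0 nx)).
    + by apply: cvg_at_right_filter; exact: Gc.
    + by apply: cvg_at_left_filter; apply: Gc.
  - move=> x; rewrite in_itv/= => /andP[nx _].
    by rewrite derive1E; case: (dG x (lt_trans n0 nx)).
have mp D : measurable_fun D (fun s : R => (s `^ q)%:E).
  by apply/measurable_EFinP; apply: measurable_funTS; exact: measurable_powR.
apply/integrableP; split; first exact: mp.
under eq_integral do rewrite gee0_abs ?lee_fin ?powR_ge0//.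
apply: (@le_lt_trans _ _ ((q + 1)^-1%:E)%E); last exact: ltry.
have F1 : `]0, 1[%classic `<=` \bigcup_i F i.
  move=> x /=; rewrite in_itv/= => /andP[x0 x1].
  have [n nx] : exists n : nat, x^-1 < n.+2%:R.
    exists (Num.truncn x^-1); apply: (lt_trans (truncnS_gt _)).
    by rewrite ltr_nat.
  exists n => //; rewrite /F/= in_itv/= (ltW x1) andbT.
  by rewrite invf_ple ?posrE ?ltr0n// ltW.
have mF n : measurable (F n) by exact: measurable_itv.
apply: (@le_trans _ _ (\int[mu]_(s in \bigcup_i F i) (s `^ q)%:E)%E).
  apply: ge0_subset_integral => //=; [by apply: bigcup_measurable => n _; exact: mF|exact: mp|].
  by move=> x _; rewrite lee_fin powR_ge0.
have cvF : (\int[mu]_(s in F n) (s `^ q)%:E)%E @[n --> \oo] -->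
    (\int[mu]_(s in \bigcup_i F i) (s `^ q)%:E)%E.
  apply: ge0_nondecreasing_set_cvg_integral => //.
  + move=> m n mn; apply/subsetPset => x; rewrite /F/= !in_itv/= => /andP[mx ->].
    rewrite andbT (le_trans _ mx)// lef_pV2 ?posrE ?ltr0n// ler_nat.
    by rewrite !ltnS.
  + by move=> n; exact: mp.
  + by move=> n x _; rewrite lee_fin powR_ge0.
by apply: (cvge_to_le cvF); exact: nearW.
Qed.

(** The integrand of Euler's Beta function at [(p + 1, q + 1)]. *)
Definition beta_integrand (p q s : R) := (1 - s) `^ p * s `^ q.

(* Since [s] or [1 - s] is at least 1/2, one factor of the beta integrand is
   always bounded. *)
Lemma powR_ge_half_le (r x : R) : 2^-1 <= x -> x <= 1 -> x `^ r <= 2 `^ `|r|.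
Proof.
move=> x2 x1; have x0 : 0 < x by apply: lt_le_trans x2; rewrite invr_gt0.
(* As [x <= 1], lowering the exponent to [- |r|] increases the power; what remains is a nonnegative
   power of [1 / x <= 2]. *)
apply: (@le_trans _ _ (x `^ (- `|r|))).
  by apply: ger_powR; rewrite ?x0 ?x1// lerNl -normrN ler_norm.
rewrite powRN -powR_inv1 ?powR_ge0// -powRrM mulrC powRrM powR_inv1 ?(ltW x0)//.
apply: ge0_ler_powR => //; rewrite ?nnegrE ?invr_ge0 ?(ltW x0)//.
by rewrite invf_ple ?posrE.
Qed.

Lemma integrable_beta (p q : R) : -1 < p -> -1 < q ->
  mu.-integrable `]0, 1[ (fun s => (beta_integrand p q s)%:E).
Proof.
(* Both factors of [K] are at least 1, so [K] dominates either one alone: the same constant serves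
   on both halves of the interval. *)
move=> p1 q1; pose K := 2 `^ `|p| * 2 `^ `|q| : R.
have K0 : 0 <= K by rewrite mulr_ge0 ?powR_ge0.
have two1 (r : R) : 1 <= 2 `^ `|r| :> R.
  by rewrite -[leLHS](powRr0 2); apply: ler_powR => //; rewrite ler1n.
(* The reflection [s |-> 1 - s] preserves []0, 1[] and moves the singularity from 0 to 1. *)
have int1 : mu.-integrable `]0, 1[ (fun s : R => ((1 - s) `^ p)%:E).
  pose I : set R := `]0, 1[%classic.
  have mI : measurable (I : set (measurableTypeR R)) by exact: measurable_itv.
  have := (integrable_mkcond _ mI).1 (integrable_powR01 p1).
  rewrite (_ : _ \_ I = EFin \o ((fun s => s `^ p) \_ I)); last first.
    by rewrite restrict_EFin.
  have N10 : -1 != 0 :> R by rewrite oppr_eq0 oner_eq0.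
  move=> /(integrable_affine 1 N10) ip.
  apply/(integrable_mkcond _ mI).
  move: ip; congr (mu.-integrable _ _); apply/funext => s.
  rewrite mulN1r addrC !patchE (_ : (1 - s \in I) = (s \in I)); first by case: ifP.
  by apply/idP/idP; rewrite /I !inE/= !in_itv/=; lra.
have -> : (fun s => (beta_integrand p q s)%:E) = EFin \o beta_integrand p q by [].
apply: (@le_integrable _ _ _ mu _ (measurable_itv _) _
  (fun s => (K%:E * ((s `^ q)%:E + ((1 - s) `^ p)%:E))%E)).
- apply/measurable_EFinP; apply: measurable_funTS; apply: measurable_funM.
    apply: (measurableT_comp (measurable_powR _)).
    by apply: measurable_funB.
  exact: measurable_powR.
- move=> s /=; rewrite in_itv/= => /andP[s0 s1].
  have q0 := powR_ge0 s q; have p0 := powR_ge0 (1 - s) p.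
  rewrite lee_fin ger0_norm ?mulr_ge0//.
  rewrite ger0_norm ?mulr_ge0 ?addr_ge0// mulrDr.
  have [s2|s2] := leP s 2^-1.
  - apply: (@le_trans _ _ (K * s `^ q)); last by rewrite lerDl mulr_ge0.
    apply: ler_wpM2r => //; apply: (@le_trans _ _ (2 `^ `|p|)).
      by apply: powR_ge_half_le; lra.
    by rewrite ler_peMr ?powR_ge0.
  - apply: (@le_trans _ _ (K * (1 - s) `^ p)); last by rewrite lerDr mulr_ge0.
    rewrite /beta_integrand mulrC; apply: ler_wpM2r => //; apply: (@le_trans _ _ (2 `^ `|q|)).
      by apply: powR_ge_half_le; lra.
    by rewrite ler_peMl ?powR_ge0.
- apply: integrableZl => //; apply: integrableD => //; exact: integrable_powR01.
Qed.

End powR_integrable.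

(** * Closure of C_{-1} under convolution *)

Section Cm1_theory.
Context {R : realType}.
Local Notation mu := (@lebesgue_measure R).
Implicit Types (f g : R -> R) (t x : R).

(* Extending by 0 turns the Laplace convolution into the convolution over the
   whole line, with no bounds of integration depending on the variables. *)
Definition on_pos f (x : R) : R := if 0 < x then f x else 0.

Lemma eq_on_pos f g : (forall x, 0 < x -> f x = g x) -> on_pos f = on_pos g.
Proof. by move=> fg; apply/funext => x; rewrite /on_pos; case: ifP => // /fg. Qed.

Lemma laplace_convE f g t :
  laplace_conv f g t = \int[mu]_x (on_pos f (t - x) * on_pos g x).
Proof.
rewrite /laplace_conv Rintegral_mkcond; apply: eq_Rintegral => x _.
rewrite patchE mem_setE in_itv/= /on_pos subr_gt0.
by case: (0 < x); case: (x < t); rewrite ?mulr0 ?mul0r.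
Qed.

Lemma laplace_conv_le0 f g t : t <= 0 -> laplace_conv f g t = 0.
Proof.
by move=> t0; rewrite /laplace_conv set_itv_ge ?Rintegral_set0// bnd_simp -leNgt.
Qed.

Lemma on_pos_laplace_conv f g : on_pos (laplace_conv f g) = laplace_conv f g.
Proof.
apply/funext => t; rewrite /on_pos; case: ifPn => //.
by rewrite -leNgt => /laplace_conv_le0 ->.
Qed.

Lemma eq_laplace_conv f f' g g' :
  (forall x, 0 < x -> f x = f' x) -> (forall x, 0 < x -> g x = g' x) ->
  laplace_conv f g = laplace_conv f' g'.
Proof.
move=> /eq_on_pos ff' /eq_on_pos gg'; apply/funext => t.
by rewrite !laplace_convE ff' gg'.
Qed.

(** The even extension [f1 \o Num.norm] turns a factor continuous on the closed half-line into one
    continuous on all of [R], so that one-sided continuity at 0 need not be carried along. *)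
Lemma Cm1P f : Cm1 f <-> exists p f1,
  [/\ -1 < p, continuous f1 & forall t : R, 0 < t -> f t = t `^ p * f1 t].
Proof.
split => [[p [f1 [p1 cf1 fE]]]|[p [f1 [p1 cf1 fE]]]]; exists p.
- exists (f1 \o Num.norm); split => //; last first.
    by move=> t t0; rewrite fE//= gtr0_norm.
  move=> x; have nx0 : `|x| \in `[0, +oo[ by rewrite in_itv/= andbT.
  have := (continuous_within_itvcyP 0 f1).1 cf1 => -[cin c0].
  have [x0|x0] := eqVneq x 0; last first.
    apply: continuous_comp; first exact: norm_continuous.
    by apply: cin; rewrite in_itv/= andbT normr_gt0.
  rewrite x0; apply/cvgrPdist_lt => e e0 /=.
  move/cvgrPdist_lt : c0 => /(_ _ e0) [d /= d0 hd].
  exists d => //= y; rewrite /ball/= sub0r normrN normr0 => yd.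
  have [->|y0] := eqVneq y 0; first by rewrite normr0 subrr normr0.
  by apply: hd; rewrite /= ?sub0r ?normrN ?normr_id ?normr_gt0.
- by exists f1; split => //; exact: continuous_subspaceT.
Qed.

Lemma Cm1_norm f : Cm1 f -> Cm1 (fun x => `|f x|).
Proof.
move=> /Cm1P[p [f1 [p1 cf1 fE]]]; apply/Cm1P; exists p, (fun x => `|f1 x|).
split => // [x|t t0].
  by apply: (continuous_comp (cf1 x)); exact: norm_continuous.
by rewrite fE// normrM ger0_norm ?powR_ge0.
Qed.

Lemma Cm1_cst (c : R) : Cm1 (fun=> c).
Proof.
apply/Cm1P; exists 0, (fun=> c); split; first by rewrite oppr_lt0.
- by move=> x; exact: cvg_cst.
- by move=> t _; rewrite powRr0 mul1r.
Qed.

Lemma Cm1_continuous f t : Cm1 f -> 0 < t -> {for t, continuous f}.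
Proof.
move=> /Cm1P[p [f1 [p1 cf1 fE]]] t0.
suff : {for t, continuous (fun x => x `^ p * f1 x)}.
  rewrite /prop_for /continuous_at fE// => h.
  apply: cvg_trans h; apply: near_eq_cvg; near=> x; rewrite fE//.
  by near: x; exact: lt_nbhsr.
by apply: cvgM; [exact: continuous_at_powR|exact: cf1].
Unshelve. all: by end_near. Qed.

Lemma measurable_on_pos f : Cm1 f -> measurable_fun setT (on_pos f).
Proof.
move=> cf; have -> : on_pos f = f \_ `]0, +oo[.
  by apply/funext => x; rewrite patchE mem_setE in_itv/= andbT.
have mI : measurable (`]0, +oo[%classic : set R) by exact: measurable_itv.
apply: (measurable_restrictT _ mI).1.
apply: open_continuous_measurable_fun; first by [].
move=> x; rewrite inE/= in_itv/= andbT; exact: Cm1_continuous.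
Qed.

Section scaled_convolution.
Variables (p q : R) (f1 g1 : R -> R).
Hypotheses (p1 : -1 < p) (q1 : -1 < q) (cf1 : continuous f1) (cg1 : continuous g1).

(** What is left of the convolution integrand at [tau = t * s] once [t ^ (p + q)] is factored out:
    the singularities no longer depend on [t]. *)
Definition scaled_integrand (t s : R) : R :=
  beta_integrand p q s * (f1 (t * (1 - s)) * g1 (t * s)).

(** For [s] in []0, 1[] both arguments stay within distance [T] of 0, where continuous functions are
    bounded. Uniformity in [t] is what domination requires. *)
Let bounded_scaled (T : R) : exists M : R, forall t s : R, `|t| < T -> 0 < s < 1 ->
  `|f1 (t * (1 - s)) * g1 (t * s)| <= M.
Proof.
have bnd (h : R -> R) : continuous h -> exists M : R, forall x : R, `|x| < T -> `|h x| <= M.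
  move=> ch; have [T0|T0] := leP T 0.
    by exists 0 => x xT; have := lt_le_trans xT T0; rewrite normr_lt0.
  have TT : - T <= T by lra.
  have cnh : continuous (fun x : R => `|h x|).
    by move=> x; apply: (continuous_comp (ch x)); exact: norm_continuous.
  have [c _ hc] := EVT_max TT (continuous_subspaceT cnh).
  exists `|h c| => x; rewrite ltr_norml => /andP[x1 x2].
  by apply: hc; rewrite in_itv/= !ltW.
have [Mf Hf] := bnd f1 cf1; have [Mg Hg] := bnd g1 cg1.
exists (Mf * Mg) => t s tT /andP[s0 s1]; rewrite normrM ler_pM//.
  apply: Hf; rewrite normrM (le_lt_trans _ tT)// ler_piMr// ger0_norm; lra.
by apply: Hg; rewrite normrM (le_lt_trans _ tT)// ler_piMr// ger0_norm; lra.
Qed.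

Let dominated_scaled (T : R) : exists M : R, forall t s : R, `|t| < T -> 0 < s < 1 ->
  `|scaled_integrand t s| <= M * beta_integrand p q s.
Proof.
have [M HM] := bounded_scaled T; exists M => t s tT s01.
have b0 : 0 <= beta_integrand p q s by rewrite mulr_ge0 ?powR_ge0.
by rewrite normrM ger0_norm// mulrC ler_wpM2r// HM.
Qed.

Let measurable_scaled t : measurable_fun setT (scaled_integrand t).
Proof.
apply: measurable_funM; first apply: measurable_funM.
- by apply: (measurableT_comp (measurable_powR _)); exact: measurable_funB.
- exact: measurable_powR.
apply: continuous_measurable_fun => s; apply: cvgM.
- apply: continuous_cvg; [exact: cf1|]; apply: cvgM; first exact: cvg_cst.
  by apply: cvgB; [exact: cvg_cst|exact: cvg_id].
- by apply: continuous_cvg; [exact: cg1|]; apply: cvgM; [exact: cvg_cst|exact: cvg_id].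
Qed.

Lemma integrable_scaled t :
  mu.-integrable `]0, 1[ (EFin \o scaled_integrand t).
Proof.
have [M HM] := dominated_scaled (`|t| + 1).
have mI : measurable (`]0, 1[%classic : set (measurableTypeR R)).
  exact: measurable_itv.
apply: (le_integrable mI _ _ (integrableZl mI M (integrable_beta p1 q1))).
  by apply/measurable_EFinP; apply: measurable_funTS; exact: measurable_scaled.
move=> s /=; rewrite in_itv/= => s01; rewrite lee_fin.
apply: le_trans (ler_norm _); apply: HM => //; lra.
Qed.

(** Dominated convergence: for parameters in []-T, T[] a fixed multiple of the beta integrand bounds
    the integrand, and [T = |t| + 1] makes [t] interior. *)
Lemma continuous_scaled :
  continuous (fun t => \int[mu]_(s in `]0, 1[) scaled_integrand t s).
Proof.
move=> t; pose T := `|t| + 1.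
have [M HM] := dominated_scaled T.
have mI : measurable (`]0, 1[%classic : set (measurableTypeR R)).
  exact: measurable_itv.
have inT (x : R) : x \in `](- T), T[%classic -> `|x| < T.
  by rewrite inE/= in_itv/= ltr_norml.
apply: (@continuity_under_integral R _ _ mu scaled_integrand _ mI (- T) T _ _
  (fun s => M * beta_integrand p q s)).
- by move=> x _; exact: integrable_scaled.
- apply: aeW => s _ x _; apply: cvgM; first exact: cvg_cst.
  apply: cvgM.
    by apply: continuous_cvg; [exact: cf1|]; apply: cvgM; [exact: cvg_id|exact: cvg_cst].
  by apply: continuous_cvg; [exact: cg1|]; apply: cvgM; [exact: cvg_id|exact: cvg_cst].
- exact: (integrableZl mI M (integrable_beta p1 q1)).
- move=> x xT; apply: aeW => s /=; rewrite in_itv/= => s01; apply: HM => //.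
  by apply: inT; rewrite inE.
- by rewrite inE/= in_itv/= -ltr_norml /T ltrDl.
Qed.

Variables f g : R -> R.
Hypotheses (fE : forall t, 0 < t -> f t = t `^ p * f1 t)
  (gE : forall t, 0 < t -> g t = t `^ q * g1 t).

Lemma laplace_integrand_scaled t s : 0 < t ->
  on_pos f (t - t * s) * on_pos g (t * s) =
  ((fun s => t `^ (p + q) * scaled_integrand t s) \_ `]0, 1[) s.
Proof.
move=> t0; rewrite patchE mem_setE in_itv/=.
have -> : t - t * s = t * (1 - s) by ring.
rewrite /on_pos !pmulr_rgt0// subr_gt0.
case: (boolP (0 < s)) => s0; case: (boolP (s < 1)) => s1; rewrite ?mulr0 ?mul0r//=.
rewrite fE ?gE ?mulr_gt0 ?subr_gt0// /scaled_integrand /beta_integrand.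
rewrite !powRM ?subr_ge0 ?ltW// powRD; last by apply/implyP => _; rewrite gt_eqF.
by ring.
Qed.

End scaled_convolution.

(** For [t <= 0] the supports of the two factors are disjoint. For [t > 0] the scaled integrand is
    integrable, and the substitution [s = x / t] transports this back. *)
Lemma integrable_laplace_conv f g t : Cm1 f -> Cm1 g ->
  mu.-integrable setT (fun x => (on_pos f (t - x) * on_pos g x)%:E).
Proof.
have [t0|t0] := leP t 0.
  move=> _ _; apply: eq_integrable (integrable0 _ _) => // x _.
  rewrite /on_pos; case: ifP => tx; last by rewrite mul0r.
  by case: ifP => x0; [exfalso; lra|rewrite mulr0].
move=> /Cm1P[p [f1 [p1 cf1 fE]]] /Cm1P[q [g1 [q1 cg1 gE]]].
have mI : measurable (`]0, 1[%classic : set (measurableTypeR R)).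
  exact: measurable_itv.
have := integrableZl mI (t `^ (p + q)) (integrable_scaled p1 q1 cf1 cg1 t).
move=> /(integrable_mkcond _ mI).
have tV0 : t^-1 != 0 by rewrite invr_neq0 ?gt_eqF.
pose F s := on_pos f (t - t * s) * on_pos g (t * s).
rewrite (_ : _ \_ _ = EFin \o F); last first.
  apply/funext => s; rewrite /= /F (laplace_integrand_scaled fE gE)//.
  by rewrite !patchE; case: ifP.
move/(integrable_affine 0 tV0); congr (mu.-integrable _ _); apply/funext => x.
by rewrite /F addr0 mulrA divff ?mul1r ?gt_eqF.
Qed.

(** Under [tau = t * s] the integrand contributes [t ^ (p + q)] and the Jacobian one more [t]. The
    exponent [p + q + 1] is above -1 because [p] and [q] are, and the remaining integral is
    continuous in [t]. *)
Lemma Cm1_laplace_conv f g : Cm1 f -> Cm1 g -> Cm1 (laplace_conv f g).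
Proof.
move=> Cf Cg; have := Cf; have := Cg.
move=> /Cm1P[q [g1 [q1 cg1 gE]]] /Cm1P[p [f1 [p1 cf1 fE]]].
apply/Cm1P; exists (p + q + 1).
exists (fun t => \int[mu]_(s in `]0, 1[) scaled_integrand p q f1 g1 t s); split.
- lra.
- exact: continuous_scaled.
move=> t t0; rewrite laplace_convE.
have tn0 : t != 0 by rewrite gt_eqF.
have mI : measurable (`]0, 1[%classic : set (measurableTypeR R)).
  exact: measurable_itv.
rewrite (Rintegral_affine 0 tn0); last first.
  by have /integrableP[/measurable_EFinP] := integrable_laplace_conv t Cf Cg.
transitivity (t * \int[mu]_(s in `]0, 1[)
    (t `^ (p + q) * scaled_integrand p q f1 g1 t s)).
  rewrite gtr0_norm// [in RHS]Rintegral_mkcond; congr (_ * _); apply: eq_Rintegral => s _.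
  by rewrite addr0 (laplace_integrand_scaled fE gE).
rewrite RintegralZl//; last exact: integrable_scaled.
by rewrite [t `^ (_ + 1)]powRD ?tn0 ?implybT// powRr1 ?ltW//; ring.
Qed.

End Cm1_theory.

(** * Algebraic laws of the convolution *)

Section laplace_conv_algebra.
Context {R : realType}.
Local Notation mu := (@lebesgue_measure R).
Implicit Types (f g h : R -> R) (t x : R).

Lemma integral_EFinE (F : R -> R) : mu.-integrable setT (EFin \o F) ->
  (\int[mu]_x (F x)%:E)%E = (\int[mu]_x F x)%:E.
Proof. by move=> iF; rewrite /Rintegral fineK//; exact: integrable_fin_num iF. Qed.

(** The substitution [x |-> t - x] swaps the two factors. *)
Lemma laplace_convC f g : Cm1 f -> Cm1 g -> laplace_conv f g = laplace_conv g f.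
Proof.
move=> Cf Cg; apply/funext => t; rewrite !laplace_convE.
have N10 : -1 != 0 :> R by rewrite oppr_eq0 oner_eq0.
rewrite (Rintegral_affine t N10); last first.
  by have /integrableP[/measurable_EFinP] := integrable_laplace_conv t Cf Cg.
rewrite normrN1 mul1r; apply: eq_Rintegral => x _.
by rewrite mulrC; congr (on_pos _ _ * on_pos _ _); ring.
Qed.

Lemma laplace_conv_linear f g h c t : Cm1 f -> Cm1 g -> Cm1 h ->
  laplace_conv f (fun x => c * g x + h x) t =
  c * laplace_conv f g t + laplace_conv f h t.
Proof.
move=> Cf Cg Ch; rewrite !laplace_convE.
have ig := integrable_laplace_conv t Cf Cg.
have ih := integrable_laplace_conv t Cf Ch.
rewrite -RintegralZl// -RintegralD//; last exact: (integrableZl measurableT c ig).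
by apply: eq_Rintegral => x _; rewrite /on_pos; case: ifP; case: ifP => _ _; ring.
Qed.

(** Fubini for the kernel [K]: integrating [z.2] first yields the left side, [z.1] first the right
    side. *)
Lemma laplace_convA f g h : Cm1 f -> Cm1 g -> Cm1 h ->
  laplace_conv f (laplace_conv g h) = laplace_conv (laplace_conv f g) h.
Proof.
move=> Cf Cg Ch; apply/funext => t.
pose K (z : R * R) := on_pos f (t - z.1) * (on_pos g (z.1 - z.2) * on_pos h z.2).
have mK : measurable_fun setT (EFin \o K).
  apply/measurable_EFinP; apply: measurable_funM.
    by apply: (measurableT_comp (measurable_on_pos Cf)); exact: measurable_funB.
  apply: measurable_funM.
    by apply: (measurableT_comp (measurable_on_pos Cg)); exact: measurable_funB.
  exact: (measurableT_comp (measurable_on_pos Ch)).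
have on_pos_norm u x : `|on_pos u x| = on_pos (fun y => `|u y|) x.
  by rewrite /on_pos; case: ifP => // _; rewrite normr0.
have innerE u v w s : Cm1 v -> Cm1 w ->
    (\int[mu]_x (on_pos u (t - s) * (on_pos v (s - x) * on_pos w x))%:E)%E =
    (on_pos u (t - s) * on_pos (laplace_conv v w) s)%:E.
  move=> Cv Cw; have iv := integrable_laplace_conv s Cv Cw.
  rewrite integral_EFinE; last exact: (integrableZl measurableT _ iv).
  by rewrite RintegralZl// -laplace_convE on_pos_laplace_conv.
(* By Tonelli, the integral of [|K|] is that of the integrand of [|f| * (|g| * |h|)] at [t], which
   is finite by closure of [Cm1] under absolute values and convolution. *)
have iK : (mu \x mu)%E.-integrable setT (EFin \o K).
  apply: (@integrable12ltyP _ _ (measurableTypeR R) (measurableTypeR R) R mu mu _ mK).2.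
  have := integrable_laplace_conv t (Cm1_norm Cf)
    (Cm1_laplace_conv (Cm1_norm Cg) (Cm1_norm Ch)).
  move=> /integrableP[_]; apply: le_lt_trans.
  apply: ge0_le_integral => //.
  - by move=> s _; exact: integral_ge0.
  - apply: (@measurable_fun_fubini_tonelli_F _ _ (measurableTypeR R)
      (measurableTypeR R) R mu (abse \o (EFin \o K))) => //.
      by apply: measurableT_comp => //; exact: mK.
    by move=> z; exact: abse_ge0.
  - apply/measurable_EFinP; apply: measurableT_comp => //.
    have := integrable_laplace_conv t (Cm1_norm Cf)
      (Cm1_laplace_conv (Cm1_norm Cg) (Cm1_norm Ch)).
    by move=> /integrableP[/measurable_EFinP].
  - move=> s _; rewrite -innerE; [|exact: Cm1_norm|exact: Cm1_norm].
    rewrite gee0_abs; last first.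
      by apply: integral_ge0 => x _; rewrite lee_fin -!on_pos_norm !mulr_ge0.
    by under eq_integral do rewrite /= !normrM !on_pos_norm.
(* For fixed [s], translating [x] by [s] exhibits the convolution of [f] and [g] at [t - s]. *)
have outerE s : (\int[mu]_x (K (x, s))%:E)%E =
    (on_pos (laplace_conv f g) (t - s) * on_pos h s)%:E.
  pose F x := on_pos f (t - s - x) * on_pos g x.
  have n0 : 1 != 0 :> R by exact: oner_neq0.
  have iF : mu.-integrable setT (EFin \o F) := integrable_laplace_conv (t - s) Cf Cg.
  have mF : measurable_fun setT F by have /integrableP[/measurable_EFinP] := iF.
  have iFs := integrable_affine (- s) n0 iF.
  transitivity (\int[mu]_x (F (1 * x - s) * on_pos h s)%:E)%E.
    apply: eq_integral => x _; rewrite /K /F/= mulrA mul1r.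
    by congr ((on_pos _ _ * _ * _)%:E); ring.
  rewrite integral_EFinE; last exact: (integrableZr measurableT _ iFs).
  rewrite RintegralZr// on_pos_laplace_conv laplace_convE.
  by rewrite [in RHS](Rintegral_affine (- s) n0)// normr1 mul1r.
apply: EFin_inj; rewrite [in LHS]laplace_convE [in RHS]laplace_convE.
have Cgh := Cm1_laplace_conv Cg Ch; have Cfg := Cm1_laplace_conv Cf Cg.
rewrite -!integral_EFinE; [|exact: integrable_laplace_conv..].
have := Fubini iK.
under eq_integral do rewrite /K/= innerE//.
by under [in RHS]eq_integral do rewrite /= outerE.
Qed.

End laplace_conv_algebra.

(** * Convolution with 1 as a primitive *)

Section primitive.
Context {R : realType}.
Local Notation mu := (@lebesgue_measure R).
Implicit Types (f g h : R -> R) (t x : R).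

Lemma Cm1_integrable f u : Cm1 f -> mu.-integrable `]0, u] (EFin \o f).
Proof.
(* Evaluating the convolution with 1 at [u + 1] rather than [u] makes its integrand agree with [f]
   up to and including [u]. *)
move=> Cf; have := integrable_laplace_conv (u + 1) (Cm1_cst 1) Cf.
have mI : measurable (`]0, u]%classic : set (measurableTypeR R)).
  exact: measurable_itv.
move=> /(integrableS measurableT mI (@subsetT _ _)).
apply: eq_integrable => // x; rewrite inE/= in_itv/= => /andP[x0 xu].
by rewrite /on_pos x0 ifT ?mul1r//; lra.
Qed.

Lemma laplace_conv_1l f t : Cm1 f ->
  laplace_conv (fun=> 1) f t = \int[mu]_(x in `]0, t]) f x.
Proof.
move=> Cf; rewrite /laplace_conv; under eq_Rintegral do rewrite mul1r.
apply: Rintegral_itv_bndo_bndc; apply: integrableS (Cm1_integrable t Cf) => //.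
exact: subset_itv_oo_oc.
Qed.

Lemma is_derive_laplace_conv_1l f t : Cm1 f -> 0 < t ->
  is_derive t 1 (laplace_conv (fun=> 1) f) (f t).
Proof.
move=> Cf t0.
have -> : laplace_conv (fun=> 1) f = fun x => \int[mu]_(y in `]0, x]) f y.
  by apply/funext => x; exact: laplace_conv_1l.
have tt1 : t < t + 1 by rewrite ltrDl.
have t0' : (BRight 0 < BRight t)%O by rewrite bnd_simp.
have [] := continuous_FTC1 tt1 (Cm1_integrable (t + 1) Cf) t0' (Cm1_continuous Cf t0).
by move=> df <-; rewrite derive1E; exact: DeriveDef.
Qed.

Lemma cvg_laplace_conv_1l f : Cm1 f ->
  laplace_conv (fun=> 1) f x @[x --> 0^'+] --> 0.
Proof.
move=> Cf; apply: cvg_at_right_filter.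
have i01 : mu.-integrable `[0, 1] (EFin \o f).
  have /integrableP[mf foo] := Cm1_integrable 1 Cf.
  apply/integrableP; split; first exact/emeasurable_fun_itv_obnd_cbndP.
  rewrite -integral_itv_obnd_cbnd//.
  by apply/measurable_EFinP; apply: measurableT_comp => //; exact/measurable_EFinP.
have := parameterized_integral_cvg_left ltr01 i01.
apply: cvg_trans; apply: near_eq_cvg; near=> x.
rewrite laplace_conv_1l// /parameterized_integral Rintegral_itv_obnd_cbnd//.
exact: Cm1_integrable.
Unshelve. all: by end_near. Qed.

(** The difference [h - H] has zero derivative on the positive half-line, hence is constant by the
    mean value theorem. Since [H] tends to 0 at [0+], the constant, read off at 1, is the limit of
    [h]. *)
Lemma Cm1_derivative_primitive h t : (forall x, 0 < x -> derivable h x 1) ->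
  Cm1 (derive1 h) -> 0 < t ->
  h t = lim (h x @[x --> 0^'+]) + laplace_conv (fun=> 1) (derive1 h) t.
Proof.
move=> dh Ch.
pose H := laplace_conv (fun=> 1) (derive1 h).
have dhH x : 0 < x -> is_derive x 1 (h - H) 0.
  move=> x0; have d1 : is_derive x 1 h (derive1 h x).
    by rewrite derive1E; apply: DeriveDef => //; exact: dh.
  by apply: (is_derive_eq (is_deriveB d1 (is_derive_laplace_conv_1l Ch x0))); rewrite subrr.
have cst x y : 0 < x -> x < y -> h y - H y = h x - H x.
  move=> x0 xy; apply/eqP; rewrite -subr_eq0; apply/eqP.
  have dxy z : z \in `]x, y[ -> is_derive z 1 (h - H) 0.
    by rewrite in_itv/= => /andP[xz _]; apply: dhH; exact: lt_trans xz.
  have cxy : {within `[x, y], continuous (h - H)}.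
    apply: derivable_within_continuous => z; rewrite in_itv/= => /andP[xz _].
    by case: (dhH z (lt_le_trans x0 xz)).
  by have [z _] := MVT xy dxy cxy; rewrite mul0r => <-.
have hE x : 0 < x -> h x = (h 1 - H 1) + H x.
  move=> x0; rewrite -[LHS](subrK (H x)); congr (_ + _).
  by have [x1|x1|->//] := ltgtP x 1; [rewrite (cst x 1)|rewrite (cst 1 x)].
suff -> : lim (h x @[x --> 0^'+]) = h 1 - H 1 by exact: hE.
apply/cvg_lim => //.
rewrite -[X in _ --> X]addr0.
apply: (@cvg_trans _ ((fun x => (h 1 - H 1) + H x) @ 0^'+)).
  apply: near_eq_cvg; near=> x; rewrite -hE//.
by apply: cvgD; [exact: cvg_cst|exact: cvg_laplace_conv_1l].
Unshelve. all: by end_near. Qed.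

End primitive.

(** * The 1st level fractional derivative *)

Section first_level_derivative.
Context {R : realType}.
Variables kappa k1 k2 : R -> R.
Hypothesis hL : kernels_1L kappa k1 k2.
Implicit Types (f g : R -> R) (t : R).

Let I := GFI kappa.
Let D := GFD_1L k1 k2.

(** The case [n = 1] of the theorem, and the step of its induction. *)
Lemma GFI_GFD_1L g t : Cm1 g -> (forall x : R, 0 < x -> derivable (GFI k2 g) x 1) ->
  Cm1 (GFD_RL k2 g) -> 0 < t ->
  g t = GFI_at0 k2 g * laplace_conv kappa k1 t + I (D g) t.
Proof.
case: hL => Ck C1 C2 h1 Cg dh Cdh t0.
set c := GFI_at0 k2 g; have C1c := Cm1_cst (1 : R).
have Ckk := Cm1_laplace_conv Ck C1; have Cd := Cm1_laplace_conv Ckk Cdh.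
have E : laplace_conv (fun=> 1) g = fun x =>
    c * laplace_conv (fun=> 1) (laplace_conv kappa k1) x +
    laplace_conv (fun=> 1)
      (laplace_conv (laplace_conv kappa k1) (GFD_RL k2 g)) x.
  (* The constant 1 is traded for [kappa * k1 * k2]; after reassociation [k2 * g] appears and can be
     expanded from its derivative. *)
  transitivity (laplace_conv (laplace_conv (laplace_conv kappa k1) k2) g).
    by apply: eq_laplace_conv => // x /h1.
  rewrite -laplace_convA//.
  transitivity (laplace_conv (laplace_conv kappa k1)
     (fun x => c * 1 + laplace_conv (fun=> 1) (GFD_RL k2 g) x)).
    apply: eq_laplace_conv => // x x0; rewrite mulr1.
    exact: (Cm1_derivative_primitive dh Cdh x0).
  apply/funext => x; rewrite laplace_conv_linear//; last exact: Cm1_laplace_conv.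
  rewrite (laplace_convA Ckk)// [laplace_conv _ (fun=> 1)]laplace_convC//.
  by rewrite -(laplace_convA C1c Ckk).
(* Both sides of [E] are differentiated at [t]; uniqueness of the derivative gives the identity. *)
have := is_derive_laplace_conv_1l Cg t0; rewrite E => dg.
have dk := is_derive_laplace_conv_1l Ckk t0.
have dd := is_derive_laplace_conv_1l Cd t0.
have := is_deriveD (is_deriveZ c dk) dd => dr.
have [_ <-] := dg; have [_ ->] := dr.
by rewrite /I /D /GFI /GFD_1L laplace_convA.
Qed.

Lemma Cm1_iter_GFI n f : Cm1 f -> Cm1 (iter n I f).
Proof.
by case: hL => Ck _ _ _ Cf; elim: n => //= n IHn; exact: Cm1_laplace_conv.
Qed.

(** Shaped to apply [I] repeatedly to the identity of [GFI_GFD_1L], which holds on the positive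
    half-line, the only place where convolution reads its arguments. *)
Lemma iter_GFI_linear n c f g h t : Cm1 f -> Cm1 g ->
  (forall x : R, 0 < x -> h x = c * f x + g x) -> 0 < t ->
  iter n I h t = c * iter n I f t + iter n I g t.
Proof.
case: (hL) => Ck _ _ _ Cf Cg hE; elim: n t => [|n IHn] t t0 /=; first exact: hE.
rewrite /I/GFI -laplace_conv_linear//; [|exact: Cm1_iter_GFI..].
by rewrite (@eq_laplace_conv _ kappa kappa _ _ _ IHn) .
Qed.

(** The argument already carries one [kappa], hence the power [n.+1] after [n] iterations. *)
Lemma iter_GFI_laplace_conv n f : Cm1 f ->
  iter n I (laplace_conv kappa f) = laplace_conv (laplace_conv_pow kappa n.+1) f.
Proof.
case: (hL) => Ck _ _ _ Cf.
have Cpow m : Cm1 (laplace_conv_pow kappa m.+1).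
  by elim: m => //= m IHm; exact: Cm1_laplace_conv.
by elim: n => // n IHn; rewrite iterS IHn /I/GFI laplace_convA.
Qed.

End first_level_derivative.

Unset Implicit Arguments.

Theorem theorem4 (R : realType) (kappa k1 k2 : R -> R)
  (hL : kernels_1L kappa k1 k2) (n : nat) (hn : (0 < n)%N)
  (f : R -> R) (hf : Cm1_1L k1 k2 n.-1 f) (t : R) (ht : 0 < t) :
  iter n (GFI kappa) (iter n (GFD_1L k1 k2) f) t =
  f t - \sum_(0 <= j < n)
          GFI_at0 k2 (iter j (GFD_1L k1 k2) f) *
          laplace_conv (laplace_conv_pow kappa j.+1) k1 t.
Proof.
case: (hL) => Ck C1 C2 _.
(* Phrasing the hypothesis with [j < n] instead of [j <= n.-1] lets the induction start at [n = 0],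
   where the sum is empty. *)
have {hn hf} : forall j, (j < n)%N ->
    let g := iter j (GFD_1L k1 k2) f in
    [/\ Cm1 g, forall t : R, 0 < t -> derivable (GFI k2 g) t 1
      & Cm1 (GFD_RL k2 g)].
  by move=> j jn; apply: hf; rewrite -ltnS prednK.
elim: n => [|n IHn] hf; first by rewrite big_nil subr0.
(* The induction hypothesis, read backwards, folds [f] minus the first [n] terms into the [n]-fold
   integral of the [n]-fold derivative; only the term of index [n] remains. *)
rewrite big_nat_recr//= opprD addrA -IHn; last by move=> j jn; apply: hf; exact: ltnW.
have [Cg dg Cdg] := hf n (ltnSn n).
have CID : Cm1 (GFI kappa (iter n.+1 (GFD_1L k1 k2) f)).
  by apply: Cm1_laplace_conv => //=; exact: Cm1_laplace_conv.
(* The one-step identity for the [n]-th derivative of [f], integrated [n] times: its boundary term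
   becomes the term of index [n] and cancels. *)
rewrite (iter_GFI_linear hL n (Cm1_laplace_conv Ck C1) CID
  (fun x => GFI_GFD_1L hL Cg dg Cdg (t := x)) ht).
by rewrite -iterSr (iter_GFI_laplace_conv hL)// addrAC subrr add0r.
Qed.
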